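(* Let $X=(X_1,\ldots,X_m)$ be the data, $T$ a real-valued test statistic, $S_m$ the group of all permutations of $\{1,\ldots,m\}$, and $G\subseteq S_m$ an arbitrary subset. For $\sigma\in G$ write $X_\sigma=(X_{\sigma(1)},\ldots,X_{\sigma(m)})$. Assume that under the null hypothesis $H_0$ the statistics $\{T(X_\sigma)\}_{\sigma\in G}$ are exchangeable, and that almost surely there are no ties among $\{T(X_\sigma)\}_{\sigma\in G}$, i.e. $\mathbb P(T(X_\sigma)=T(X_{\sigma'})\text{ for some }\sigma\ne\sigma',\ \sigma\in G,\ \sigma'\in G)=0$. Let $B\le|G|$, let $\sigma_1^*,\ldots,\sigma_B^*$ be drawn uniformly with replacement from $G$, and let $T^*_{(1)}\le\cdots\le T^*_{(B)}$ be the order statistics of $T(X_{\sigma_1^*}),\ldots,T(X_{\sigma_B^*})$. For $\alpha\in(0,1)$ define the test $$\phi(X)=\begin{cases}\mathbf 1\{T(X)\ge T^*_{(\lceil B(1-\alpha)\rceil+2)}\}&\text{if }B=|G|,\\ \mathbf 1\{T(X)\ge T^*_{(\lceil(B+1)(1-\alpha)\rceil+1)}\}&\text{if }B<|G|.\end{cases}$$ Then, for any subset $G\subseteq S_m$ and any $B\le|G|$, $$\alpha-\frac{2+\alpha\mathbf 1\{B=|G|\}}{B+1}-\frac1{|G|}\le\mathbb E_{H_0}[\phi(X)]\le\alpha.$$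
   Context: $\mathbb E_{H_0}$ is expectation under the null hypothesis, over both the data and the random permutations. Conditionally on the data, the statistics $T(X_{\sigma_1^*}),\ldots,T(X_{\sigma_B^*})$ are independent and identically distributed.
   Formalization: Exchangeability is assumed for the statistics T(X_σ) with σ in G together with T(X) itself (G plus the identity); if the identity is not in G, exchangeability over G alone does not constrain T(X) and the claim fails. *)

(* Defs.v *)
From HB Require Import structures.
From mathcomp Require Import all_boot all_order all_algebra all_fingroup.
From mathcomp Require Import all_classical all_reals all_analysis.

Set Implicit Arguments.
Unset Strict Implicit.
Unset Printing Implicit Defensive.

Import Order.TTheory GRing.Theory Num.Theory.

Local Open Scope classical_set_scope.
Local Open Scope ring_scope.

Definition permute_data {S : Type} {m : nat} (sigma : 'S_m) (x : m.-tuple S) :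
    m.-tuple S :=
  [tuple tnth x (sigma i) | i < m].

(* The family (Y i)_(i in A) is exchangeable: its joint law, as a probability
   on the product sigma-algebra of R^#|A|, is invariant under every permutation
   of the index set A. *)
Definition exchangeable_on {d : measure_display} {Omega : measurableType d}
    {R : realType} (P : probability Omega R) {I : finType} (A : {set I})
    (Y : I -> Omega -> R) : Prop :=
  forall pi : {perm I}, perm_on A pi ->
  forall C : set (#|A|.-tuple R), measurable C ->
    P [set w | C [tuple Y (pi (enum_val i)) w | i < #|A|]] =
    P [set w | C [tuple Y (enum_val i) w | i < #|A|]].

Definition no_ties_on {d : measure_display} {Omega : measurableType d}
    {R : realType} (P : probability Omega R) {I : finType} (A : {set I})
    (Y : I -> Omega -> R) : Prop :=
  P [set w | exists i j, [/\ i \in A, j \in A, i != j & Y i w = Y j w]] = 0%E.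

(* s_0, ..., s_(B-1) are random elements of the finite type I (with its discrete
   sigma-algebra), each uniform on G, and X, s_0, ..., s_(B-1) are mutually
   independent.  The product rule for subfamilies is obtained by taking
   D = setT, resp. C b = [set: I]. *)
Definition uniform_draws {d d' : measure_display} {Omega : measurableType d}
    {R : realType} (P : probability Omega R) {E : measurableType d'}
    (X : Omega -> E) {I : finType} (G : {set I}) {B : nat}
    (s : 'I_B -> Omega -> I) : Prop :=
  [/\ forall b g, measurable [set w | s b w = g],
      forall b g, P [set w | s b w = g] =
        (if g \in G then (#|G|%:R)^-1 else 0)%:E
    & forall (D : set E) (C : 'I_B -> {set I}), measurable D ->
        P [set w | D (X w) /\ forall b, s b w \in C b] =
        (P [set w | D (X w)] * \prod_(b < B) P [set w | s b w \in C b])%E].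

(* k-th smallest element of s, counted from 1, with the usual convention that
   it is +oo for k > size s; the thresholds below do exceed the sample size
   when alpha is small, and the test then never rejects. *)
Definition order_stat {R : realType} (s : seq R) (k : nat) : \bar R :=
  nth +oo%E [seq x%:E | x <- sort <=%R s] k.-1.

(* Only used with alpha < 1, where the ceilings are nonnegative and the absolute
   value is just the conversion from int to nat. *)
Definition threshold_index {R : realType} (N B : nat) (alpha : R) : nat :=
  if B == N then (`|Num.ceil (B%:R * (1 - alpha))| + 2)%N
  else (`|Num.ceil (B.+1%:R * (1 - alpha))| + 1)%N.

Definition perm_test {R : realType} {S : Type} {m : nat}
    (T : m.-tuple S -> R) (G : {set 'S_m}) (alpha : R) {B : nat}
    (s : 'I_B -> 'S_m) (x : m.-tuple S) : R :=
  (order_stat [seq T (permute_data (s b) x) | b <- enum 'I_B]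
     (threshold_index #|G| B alpha) <= (T x)%:E)%E%:R.

(* Main.v *)
(* Let N = #|G|, let G1 be G together with the identity, k the threshold index and
   r = B - k.  The test rejects iff at most r of the B draws give a value above
   T(X).  By exchangeability T(X) may be replaced by T(X_t) with t uniform in G1;
   almost surely the ranks of the t in G1 are 0, ..., #|G1| - 1, so the rejection
   probability is the average over j < #|G1| of the probability F(j) that at most r
   of B uniform draws from {0, ..., N-1} fall below j.  Since F(N) = 0, only the sum
   over j < N matters, whether or not the identity lies in G.  Regarding j as one more
   uniform draw, symmetry among the B + 1 draws shows that the average of F(0), ...,
   F(N-1) is at least (r + 1) / (B + 1), because at least r + 1 of the draws have at
   most r draws strictly below them, and that the average of F(1), ..., F(N) is at
   most (r + 1) / (B + 1), because at most r + 1 of them have at most r other draws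
   weakly below them.  The two averages differ by at most 1 / N. *)

Require Import Defs.
From HB Require Import structures.
From mathcomp Require Import all_boot all_order all_algebra all_fingroup.
From mathcomp Require Import all_classical all_reals all_analysis.
From mathcomp Require Import measurable_realfun ring lra zify.

Set Implicit Arguments.
Unset Strict Implicit.
Unset Printing Implicit Defensive.

Import Order.TTheory GRing.Theory Num.Theory.

(** * Counting vectors of draws with few hits *)

(** For [z <= N] this is [N ^ n] times the binomial distribution function at [r], with [n] trials
    and success probability [z / N]; [D] is the set of draws that hit. *)
Definition few_hits (n r N z : nat) : nat :=
  \sum_(D : {set 'I_n} | #|D| <= r) z ^ #|D| * (N - z) ^ (n - #|D|).

Lemma card_few_hits (I : finType) (n r : nat) (A Z : {set I}) : Z \subset A ->
  #|[set f : {ffun 'I_n -> I} |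
      (f \in ffun_on A) && (#|[set b | f b \in Z]| <= r)]| =
  few_hits n r #|A| #|Z|.
Proof.
move=> ZA; rewrite -sum1_card.
rewrite (partition_big (fun f : {ffun 'I_n -> I} => [set b | f b \in Z])
  (fun D => #|D| <= r)) /=; last by move=> f; rewrite inE => /andP[].
apply: eq_bigr => D leD.
pose F (b : 'I_n) : {set I} := if b \in D then Z else A :\: Z.
transitivity #|family F|.
  rewrite sum1_card; apply: eq_card => f; rewrite [LHS]unfold_in inE.
  apply/idP/familyP => [/andP[/andP[/ffun_onP fA _] /eqP fD] b|fF].
    by rewrite /F -fD inE; case: ifP => fb //; rewrite inE fb fA.
  have fD : [set b | f b \in Z] = D.
    apply/finset.setP => b; rewrite inE; have := fF b; rewrite /F.
    by case: ifP => // _; rewrite inE => /andP[/negbTE].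
  rewrite fD leD eqxx !andbT; apply/ffun_onP => b.
  have := fF b; rewrite /F; case: ifP => _; first exact: (fintype.subsetP ZA).
  by rewrite inE => /andP[].
rewrite card_family foldrE big_image (bigID (mem D)) /=.
rewrite (eq_bigr (fun=> #|Z|)); last by move=> b bD; rewrite /F bD.
rewrite prod_nat_const [X in _ * X = _](eq_bigr (fun=> #|A| - #|Z|)); last first.
  by move=> b bD; rewrite /F (negbTE bD) cardsD (finset.setIidPr ZA).
rewrite prod_nat_const -[X in X - #|D|](card_ord n) -(cardC (mem D)) addKn.
by congr (_ ^ _ * _ ^ _).
Qed.

(** If [L] had at most [r] elements, take an index outside [L] with least [h]: everything strictly
    below it lies in [L], so it belongs to [L] after all. *)
Lemma card_lt_few (J : finType) (h : J -> nat) (r : nat) : r < #|J| ->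
  r < #|[set i | #|[set b | h b < h i]| <= r]|.
Proof.
move=> rJ; set L := [set i | _]; rewrite ltnNge; apply/negP => leL.
have /card_gt0P[i0 i0L] : 0 < #|~: L|.
  by rewrite cardsCs finset.setCK subn_gt0 (leq_ltn_trans leL).
case: (arg_minnP (P := mem (~: L)) h i0L) => i /=; rewrite inE => /negP iL imin; apply: iL.
rewrite inE (leq_trans _ leL) // subset_leq_card //; apply/fintype.subsetP => b.
rewrite inE; apply: contraLR => bL; rewrite -leqNgt; apply: imin.
by rewrite /= inE.
Qed.

(** The whole set lies weakly below its own member with largest [h], and that member has at most [r]
    indices weakly below it. *)
Lemma card_le_few (J : finType) (h : J -> nat) (r : nat) :
  #|[set i | #|[set b | h b <= h i]| <= r]| <= r.
Proof.
set U := [set i | _]; have [->|[i0 i0U]] := finset.set_0Vmem U; first by rewrite cards0.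
case: (arg_maxnP (P := mem U) h i0U) => i /=; rewrite inE => iU imax.
rewrite (leq_trans _ iU) // subset_leq_card //; apply/fintype.subsetP => b bU.
by rewrite inE; apply: imax.
Qed.

Section FirstDraw.
Variables (n N : nat).

Let cons_draw (p : 'I_N * {ffun 'I_n -> 'I_N}) : {ffun 'I_n.+1 -> 'I_N} :=
  [ffun i => if unlift ord0 i is Some b then p.2 b else p.1].
Let split_draw (h : {ffun 'I_n.+1 -> 'I_N}) : 'I_N * {ffun 'I_n -> 'I_N} :=
  (h ord0, [ffun b => h (lift ord0 b)]).

(* All n.+1 coordinates play the same role, so the first one can be averaged. *)
Lemma sum_first_draw (Q : rel nat) (r : nat) (c : bool) :
  (forall i, Q i i = c) ->
  n.+1 * \sum_(j < N)
     #|[set f : {ffun 'I_n -> 'I_N} | #|[set b | Q (f b) j]| + c <= r]| =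
  \sum_(h : {ffun 'I_n.+1 -> 'I_N})
     #|[set i | #|[set b | Q (h b) (h i)]| <= r]|.
Proof.
move=> Qii.
pose W i := \sum_(h : {ffun 'I_n.+1 -> 'I_N}) (#|[set b | Q (h b) (h i)]| <= r : nat).
transitivity (\sum_(i < n.+1) W i); last first.
  rewrite exchange_big; apply: eq_bigr => h _.
  by rewrite -[RHS]sum1_card [RHS]big_mkcond /=; apply: eq_bigr => i _; rewrite inE; case: ifP.
transitivity (n.+1 * W ord0).
  congr (_ * _).
  pose V (h : {ffun 'I_n.+1 -> 'I_N}) : nat := #|[set b | Q (h b) (h ord0)]| <= r.
  transitivity (\sum_(j < N) \sum_(f : {ffun 'I_n -> 'I_N}) V (cons_draw (j, f))).
    apply: eq_bigr => j _; rewrite -[LHS]sum1_card [LHS]big_mkcond /=.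
    apply: eq_bigr => f _; rewrite /V inE; set x := _ + c; set y := #|_|.
    suff -> : x = y by case: ifP.
    (* The first draw is also compared with itself; this term contributes [c]. *)
    rewrite /x /y -!sum1_card big_mkcond [in RHS]big_mkcond /= big_ord_recl addnC.
    rewrite inE /cons_draw !ffunE unlift_none /= Qii; congr addn.
    by apply: eq_bigr => b _; rewrite !inE ffunE liftK.
  rewrite pair_big /= [RHS](reindex cons_draw) /=; first by apply: eq_bigr => -[].
  exists split_draw => [[j f]|h] _.
    rewrite /split_draw /cons_draw ffunE unlift_none /=; congr pair.
    by apply/ffunP => b; rewrite !ffunE liftK.
  apply/ffunP => i; rewrite ffunE /=; case: unliftP => [b ->|->//].
  by rewrite ffunE.
rewrite (eq_bigr (fun=> W ord0)) ?sum_nat_const ?card_ord // => i _.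
pose p (h : {ffun 'I_n.+1 -> 'I_N}) := [ffun k => h (tperm ord0 i k)].
rewrite /W (reindex_inj (h := p)) /=; last first.
  move=> h h' /ffunP e; apply/ffunP => k.
  by have := e (tperm ord0 i k); rewrite !ffunE tpermK.
apply: eq_bigr => h _; congr (nat_of_bool (_ <= _)).
rewrite -(card_imset _ (@perm_inj _ (tperm ord0 i))); apply: eq_card => b.
rewrite !inE; apply/imsetP/idP => [[k]|].
  by rewrite inE !ffunE tpermR => Qk ->.
move=> Qb; exists (tperm ord0 i b); last by rewrite tpermK.
by rewrite inE !ffunE tpermK tpermR.
Qed.

End FirstDraw.

Lemma few_hits_ord (n r N j : nat) : j <= N ->
  few_hits n r N j = #|[set f : {ffun 'I_n -> 'I_N} | #|[set b | f b < j]| <= r]|.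
Proof.
move=> jN; have cardj : #|[set i : 'I_N | i < j]| = j.
  by rewrite -sum1_card (eq_bigl (fun i : 'I_N => i < j)) => [|i];
    rewrite ?inE // -(big_ord_widen _ (fun=> 1) jN) sum_nat_const card_ord muln1.
rewrite -{1}cardj -{1}[N]card_ord -finset.cardsT -card_few_hits ?finset.subsetT //.
apply: eq_card => f; rewrite [LHS]inE [RHS]inE.
have -> /= : f \in ffun_on [set: 'I_N] by apply/ffun_onP => b; rewrite inE.
by congr (_ <= _); apply: eq_card => b; rewrite !inE.
Qed.

Lemma few_hits_sum_lb (n r N : nat) : r <= n ->
  r.+1 * N ^ n.+1 <= n.+1 * \sum_(j < N) few_hits n r N j.
Proof.
move=> rn; rewrite (eq_bigr _ (fun (j : 'I_N) _ => few_hits_ord n r (ltnW (ltn_ord j)))).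
have -> : n.+1 * \sum_(j < N) #|[set f : {ffun 'I_n -> 'I_N} | #|[set b | f b < j]| <= r]| =
    \sum_(h : {ffun 'I_n.+1 -> 'I_N}) #|[set i | #|[set b | h b < h i]| <= r]|.
  rewrite -(@sum_first_draw n N ltn r false ltnn); congr (_ * _).
  by apply: eq_bigr => j _; apply: eq_card => f; rewrite !inE addn0.
have -> : N ^ n.+1 = #|{ffun 'I_n.+1 -> 'I_N}| by rewrite card_ffun !card_ord.
rewrite mulnC -sum_nat_const.
by apply: leq_sum => h _; rewrite card_lt_few ?card_ord.
Qed.

(** Here [f b < j.+1] means [f b <= j]. Each draw is weakly below itself, so among all [n.+1] draws
    the allowance [r] becomes [r.+1]. *)
Lemma few_hits_sum_ub (n r N : nat) :
  n.+1 * \sum_(j < N) few_hits n r N j.+1 <= r.+1 * N ^ n.+1.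
Proof.
rewrite (eq_bigr _ (fun (j : 'I_N) _ => few_hits_ord n r (ltn_ord j))).
have -> : n.+1 * \sum_(j < N) #|[set f : {ffun 'I_n -> 'I_N} | #|[set b | f b < j.+1]| <= r]| =
    \sum_(h : {ffun 'I_n.+1 -> 'I_N}) #|[set i | #|[set b | h b <= h i]| <= r.+1]|.
  rewrite -(@sum_first_draw n N leq r.+1 true leqnn); congr (_ * _).
  by apply: eq_bigr => j _; apply: eq_card => f; rewrite !inE addn1 ltnS.
have -> : N ^ n.+1 = #|{ffun 'I_n.+1 -> 'I_N}| by rewrite card_ffun !card_ord.
rewrite mulnC -sum_nat_const.
by apply: leq_sum => h _; rewrite card_le_few.
Qed.

Lemma few_hits_le (n r N j : nat) : j <= N -> few_hits n r N j <= N ^ n.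
Proof.
move=> jN; rewrite few_hits_ord // (leq_trans (max_card _)) //.
by rewrite card_ffun !card_ord.
Qed.

(** At least one draw would have to miss, but every point is a hit. *)
Lemma few_hits_all (n r N : nat) : r < n -> few_hits n r N N = 0.
Proof.
move=> rn; rewrite /few_hits big1 // => D leD.
by rewrite subnn exp0n ?muln0 // subn_gt0 (leq_ltn_trans leD).
Qed.

(** * Ranks and exceedance counts *)

(** In the absence of ties the ranks are distinct and below [#|A|], hence they run through all of
    [0, ..., #|A| - 1]. *)
Lemma sum_card_gt (disp : Order.disp_t) (V : orderType disp) (I : finType)
    (A : {set I}) (y : I -> V) (h : nat -> nat) : {in A &, injective y} ->
  \sum_(t in A) h #|[set g in A | (y t < y g)%O]| = \sum_(j < #|A|) h j.
Proof.
move=> yinj; pose rk t := #|[set g in A | (y t < y g)%O]|.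
have rk_lt t : t \in A -> rk t < #|A|.
  move=> tA; apply: proper_card; apply/properP; split.
    by apply/fintype.subsetP => g; rewrite inE => /andP[].
  by exists t => //; rewrite inE Order.POrderTheory.ltxx andbF.
have [->|[t0 t0A]] := finset.set_0Vmem A; first by rewrite big_set0 cards0 big_ord0.
have A0 : 0 < #|A| by apply/card_gt0P; exists t0.
pose rko t : 'I_#|A| := insubd (Ordinal A0) (rk t).
have rkoE t : t \in A -> rko t = rk t :> nat by move=> tA; rewrite val_insubd rk_lt.
have rk_mono t u : t \in A -> u \in A -> (y t < y u)%O -> rk u < rk t.
  move=> tA uA tu; apply: proper_card; apply/properP; split.
    apply/fintype.subsetP => g; rewrite !inE => /andP[-> ug].
    exact: Order.POrderTheory.lt_trans ug.
  by exists u; rewrite !inE uA //= Order.POrderTheory.ltxx.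
have rko_inj : {in A &, injective rko}.
  move=> t u tA uA /(congr1 val) /=; rewrite !rkoE // => e; apply: yinj => //.
  have [ltu|gtu|//] := Order.TotalTheory.ltgtP (y t) (y u).
    by have := rk_mono t u tA uA ltu; rewrite e ltnn.
  by have := rk_mono u t uA tA gtu; rewrite e ltnn.
transitivity (\sum_(t in A) h (rko t)).
  by apply: eq_bigr => t tA; rewrite rkoE.
rewrite -(big_imset (fun j : 'I_#|A| => h j) rko_inj) /=.
have -> : rko @: A = [set: 'I_#|A|].
  by apply/eqP; rewrite eqEcard finset.subsetT finset.cardsT card_ord card_in_imset ?leqnn.
by apply: eq_bigl => j; rewrite inE.
Qed.

Definition exceed {disp : Order.disp_t} {V : orderType disp} {I J : finType}
    (y : I -> V) (t : I) (f : J -> I) : nat := #|[set b | (y t < y (f b))%O]|.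

Lemma eq_exceed (disp : Order.disp_t) (V : orderType disp) (I I' J : finType)
    (y : I -> V) (y' : I' -> V) (t : I) (t' : I') (f : J -> I) (f' : J -> I') :
  y t = y' t' -> (forall b, y (f b) = y' (f' b)) -> exceed y t f = exceed y' t' f'.
Proof. by move=> yt yf; apply: eq_card => b; rewrite !inE yt yf. Qed.

(* The draws enter only through the number of elements of [G] whose image under
   [tperm e t] beats [t], which is the rank of [t] in [e |: G], whether or not [e]
   belongs to [G]. *)
Lemma sum_exceed_tperm (disp : Order.disp_t) (V : orderType disp) (I : finType)
    (n r : nat) (e : I) (G : {set I}) (y : I -> V) :
  {in e |: G &, injective y} ->
  \sum_(t in e |: G) \sum_(f : {ffun 'I_n -> I} | f \in ffun_on G)
     (exceed y t (tperm e t \o f) <= r : nat) =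
  \sum_(j < #|e |: G|) few_hits n r #|G| j.
Proof.
move=> yinj; rewrite -(sum_card_gt (few_hits n r #|G|) yinj).
apply: eq_bigr => t teG.
pose Z := [set g in G | (y t < y (tperm e t g))%O].
have -> : #|[set g in e |: G | (y t < y g)%O]| = #|Z|.
  rewrite -[RHS](card_imset _ (@perm_inj _ (tperm e t))); apply: eq_card => g.
  rewrite [LHS]inE; apply/andP/imsetP => [[geG ltg]|[h]].
    exists (tperm e t g); last by rewrite tpermK.
    (* If [g] is [e], the preimage is [t], which lies in [G] unless [t = e], and then [t] would beat
       itself. The case [g = t] fails for the same reason, and any other [g] is fixed and lies in
       [G]. *)
    rewrite inE tpermK ltg andbT; case: tpermP => [ge|gt|ne _].
    - move: teG; rewrite !inE => /predU1P[te|//].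
      by move: ltg; rewrite ge te Order.POrderTheory.ltxx.
    - by move: ltg; rewrite gt Order.POrderTheory.ltxx.
    - by move: geG; rewrite !inE => /predU1P[].
  rewrite inE => /andP[hG lth] ->; split=> //.
  by case: tpermP => // _; rewrite !inE ?eqxx // hG orbT.
rewrite -card_few_hits; last by apply/fintype.subsetP => g; rewrite inE => /andP[].
rewrite -[RHS]sum1_card [RHS]big_mkcond [LHS]big_mkcond /=.
apply: eq_bigr => f _; rewrite finset.in_set; case: (boolP (f \in _)) => //= fG.
have -> : exceed y t (tperm e t \o f) = #|[set b | f b \in Z]|.
  by apply: eq_card => b; rewrite !inE /= (ffun_onP fG).
by case: (_ <= r).
Qed.

Local Open Scope ring_scope.

(** * The test as a bound on an exceedance count *)

Lemma order_stat_le (R : realType) (s : seq R) (k : nat) (x : R) :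
  (0 < k)%N -> (order_stat s k <= x%:E)%E = (k <= count (<= x) s)%N.
Proof.
move=> k0; have ss : sorted <=%R (sort <=%R s) by exact: sort_le_sorted.
rewrite -(count_sort <=%R) /order_stat; have [ks|sk] := ltnP k.-1 (size s).
  rewrite (nth_map 0) ?size_sort // lee_fin -[k in RHS](prednK k0).
  apply/idP/idP => [|lt]; last exact: nth_count_le.
  by apply: contraTT; rewrite -leqNgt -ltNge => ge; rewrite nth_count_gt // ge size_sort.
(* Beyond the sample size the order statistic is [+oo], and no count can reach [k]: both sides are
   false. *)
rewrite nth_default ?size_map ?size_sort // leye_eq /=.
apply/esym/negbTE; rewrite -ltnNge -(prednK k0) ltnS.
by rewrite (leq_trans (count_size _ _)) // size_sort.
Qed.

(** Draws with value at most [T x] and draws above it add up to [B], so at least [k] of the former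
    means at most [B - k] of the latter. *)
Lemma perm_testE (R : realType) (S : Type) (m B : nat) (T : m.-tuple S -> R)
    (G : {set 'S_m}) (alpha : R) (s : 'I_B -> 'S_m) (x : m.-tuple S)
    (k := threshold_index #|G| B alpha) : (0 < k <= B)%N ->
  perm_test T G alpha s x =
  (exceed (fun g => T (permute_data g x)) 1%g s <= B - k)%N%:R.
Proof.
move=> /andP[k0 kB]; rewrite /perm_test order_stat_le // -/k count_map.
congr (nat_of_bool _)%:R.
have T1 : T (permute_data 1%g x) = T x.
  by congr (T _); apply: eq_from_tnth => i; rewrite tnth_mktuple perm1.
set p := preim _ _.
have -> : exceed (fun g => T (permute_data g x)) 1%g s = count (predC p) (enum 'I_B).
  rewrite /exceed T1 cardsE cardE size_filter enumT.
  by apply: eq_count => b; rewrite /= -ltNge.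
have : (count p (enum 'I_B) + count (predC p) (enum 'I_B) = B)%N.
  by rewrite count_predC size_enum_ord.
move: (count p _) (count (predC p) _) => u v uvB; lia.
Qed.

Lemma perm_test_over (R : realType) (S : Type) (m B : nat) (T : m.-tuple S -> R)
    (G : {set 'S_m}) (alpha : R) (s : 'I_B -> 'S_m) (x : m.-tuple S) :
  (B < threshold_index #|G| B alpha)%N -> perm_test T G alpha s x = 0.
Proof.
move=> Bk; rewrite /perm_test order_stat_le ?(leq_trans _ Bk) //.
rewrite leqNgt (leq_ltn_trans _ Bk) // (leq_trans (count_size _ _)) //.
by rewrite size_map size_enum_ord.
Qed.

(** * Measurability, exchangeability and ties *)

Lemma measurable_permute_data (d : measure_display) (S : measurableType d)
    (m : nat) (g : 'S_m) :
  measurable_fun [set: m.-tuple S] (permute_data g).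
Proof.
apply/measurable_fun_tnthP => i.
rewrite (_ : _ \o _ = @tnth _ S ^~ (g i)); first exact: measurable_tnth.
by apply/funext => x /=; rewrite tnth_mktuple.
Qed.

Local Open Scope classical_set_scope.

Lemma measurable_exceed (d : measure_display) (E : measurableType d)
    (R : realType) (I J : finType) (Y : I -> E -> R) (t : I) (f : J -> I) (r : nat) :
  measurable_fun setT (Y t) -> (forall b, measurable_fun setT (Y (f b))) ->
  measurable [set w | (exceed (Y ^~ w) t f <= r)%N].
Proof.
move=> mt mf.
have exceedE w : (exceed (Y ^~ w) t f <= r)%N =
    (\sum_(b : J) (if Y t w < Y (f b) w then 1 else 0) <= r%:R :> R).
  rewrite /exceed -sum1_card big_mkcond -(ler_nat R) natr_sum.
  congr (_ <= _); apply: eq_bigr => b _; rewrite finset.in_set.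
  by case: ifP.
under eq_set do rewrite exceedE.
rewrite -[X in measurable X]setTI; apply: measurable_fun_ler => //.
apply: measurable_sum => b; apply: measurable_fun_ifT => //.
exact: measurable_fun_ltr.
Qed.

Lemma perm_on_tperm (I : finType) (A : {set I}) (x y : I) :
  x \in A -> y \in A -> perm_on A (tperm x y).
Proof.
move=> xA yA; apply: fintype.subset_trans (tperm_on x y) _.
by apply/fintype.subsetP => z; rewrite !inE => /orP[] /eqP->.
Qed.

Section Probability.
Context {d : measure_display} {Omega : measurableType d} {R : realType}.
Variable P : probability Omega R.

Lemma measurable_event (E : Omega -> bool) : measurable [set w | E w] ->
  measurable_fun setT (fun w => (E w)%:R : R).
Proof.
move=> mE; rewrite (_ : (fun w => _) = \1_[set w | E w]).
  exact: measurable_indic.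
by apply/funext => w; rewrite indicE; congr (nat_of_bool _)%:R; apply/idP/idP; rewrite inE.
Qed.

Lemma expectation_sum_events (I : finType) (Q : pred I) (E : I -> Omega -> bool) :
  (forall i, Q i -> measurable [set w | E i w]) ->
  ('E_P[fun w => (\sum_(i | Q i) (E i w)%:R)%R] = \sum_(i | Q i) P [set w | E i w])%E.
Proof.
move=> mE; rewrite unlock.
under eq_integral do rewrite -sumEFin big_mkcond.
rewrite ge0_integral_sum //=.
- rewrite [RHS]big_mkcond; apply: eq_bigr => i _; case: ifPn => Qi; last exact: integral0.
  rewrite -[in RHS](setIT [set w | E i w]) -integral_indic //; last exact: mE.
  apply: eq_integral => w _; rewrite indicE; congr ((nat_of_bool _)%:R%:E).
  by apply/idP/idP; rewrite inE.
- move=> i; have [Qi|_] := boolP (Q i); last exact: measurable_cst.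
  by apply/measurable_EFinP/measurable_event/mE.
- by move=> i w _; case: ifP => // _; rewrite lee_fin.
Qed.

(** Carries an almost sure count of occurring events over to their probabilities; it is applied to
    the count in [sum_exceed_tperm]. *)
Lemma sum_prob_events (I : finType) (Q : pred I) (E : I -> Omega -> bool) (c : R) :
  (forall i, Q i -> measurable [set w | E i w]) ->
  {ae P, forall w, \sum_(i | Q i) (E i w)%:R = c} ->
  (\sum_(i | Q i) P [set w | E i w] = c%:E)%E.
Proof.
move=> mE sE; rewrite -expectation_sum_events // -(expectation_cst P c) unlock.
apply: ae_eq_integral => //.
  apply/measurable_EFinP; under eq_fun do rewrite big_mkcond.
  apply: measurable_sum => i; have [Qi|_] := boolP (Q i); last exact: measurable_cst.
  exact/measurable_event/mE.
  by apply/measurable_EFinP; exact: measurable_cst.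
by apply: filterS sE => w /= -> _.
Qed.

(** Both events say that the tuple of values, permuted or not, falls in one measurable set [C]; [rk]
    translates elements of [A] into coordinates. *)
Lemma exchangeable_exceed (I J : finType) (A : {set I}) (Y : I -> Omega -> R)
    (pi : {perm I}) (t : I) (f : J -> I) (r : nat) :
  exchangeable_on P A Y -> perm_on A pi -> t \in A -> (forall b, f b \in A) ->
  P [set w | (exceed (Y ^~ w) (pi t) (pi \o f) <= r)%N] =
  P [set w | (exceed (Y ^~ w) t f <= r)%N].
Proof.
move=> exch piA tA fA; pose rk := enum_rank_in tA.
pose C := [set u : #|A|.-tuple R |
  (exceed (fun i => tnth u i) (rk t) (rk \o f) <= r)%N].
have mC : measurable C.
  by apply: (measurable_exceed (Y := fun i u => tnth u i)) => *; exact: measurable_tnth.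
have tupleE (g : I -> I) w :
    exceed (fun i => tnth [tuple Y (g (enum_val i)) w | i < #|A|] i) (rk t) (rk \o f) =
    exceed (Y ^~ w) (g t) (g \o f).
  by apply: eq_exceed => [|b]; rewrite tnth_mktuple /= enum_rankK_in.
have := exch pi piA C mC; rewrite /C /=.
under eq_set do rewrite tupleE; move=> ->.
by under eq_set do rewrite (tupleE id).
Qed.

Lemma exchangeable_eq (I : finType) (A : {set I}) (Y : I -> Omega -> R)
    (pi : {perm I}) (s t : I) :
  exchangeable_on P A Y -> perm_on A pi -> s \in A -> t \in A ->
  P [set w | Y (pi s) w = Y (pi t) w] = P [set w | Y s w = Y t w].
Proof.
move=> exch piA sA tA; pose rk := enum_rank_in tA.
pose C := [set u : #|A|.-tuple R | tnth u (rk s) == tnth u (rk t)].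
have mC : measurable C.
  rewrite -[X in measurable X]setTI; apply: measurable_fun_eqr => //; exact: measurable_tnth.
have tupleE (g : I -> I) : [set w | C [tuple Y (g (enum_val i)) w | i < #|A|]] =
    [set w | Y (g s) w = Y (g t) w].
  by apply/seteqP; split => w; rewrite /C /= !tnth_mktuple !enum_rankK_in // => /eqP.
by have := exch pi piA C mC; rewrite tupleE (tupleE id).
Qed.

Lemma measurable_eq_event (Y Z : Omega -> R) :
  measurable_fun setT Y -> measurable_fun setT Z -> measurable [set w | Y w = Z w].
Proof.
move=> mY mZ; rewrite (_ : [set w | _] = [set w | Y w == Z w]).
  by rewrite -[X in measurable X]setTI; apply: measurable_fun_eqr.
by apply/seteqP; split => w /eqP.
Qed.

Lemma ae_inj (I : finType) (A : {set I}) (Y : I -> Omega -> R) :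
  (forall i, i \in A -> measurable_fun setT (Y i)) ->
  (forall i j, i \in A -> j \in A -> i != j -> P [set w | Y i w = Y j w] = 0%E) ->
  {ae P, forall w, {in A &, injective (Y ^~ w)}}.
Proof.
move=> mY Y0.
have : {ae P, forall w, forall p : I * I, p.1 \in A -> p.2 \in A -> Y p.1 w = Y p.2 w -> p.1 = p.2}.
  apply: filter_forall => -[i j] /=.
  have [->|ij] := eqVneq i j; first exact: aeW.
  have [iA|] := boolP (i \in A); last by move=> _; exact: aeW.
  have [jA|] := boolP (j \in A); last by move=> _; exact: aeW.
  exists [set w | Y i w = Y j w]; split; last 1 first.
  - by move=> w /=; apply: contra_notP => Yij _ _ /Yij.
  - by apply: measurable_eq_event; exact: mY.
  - exact: Y0.
by apply: filterS => w H i j iA jA e; exact: (H (i, j)).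
Qed.

(* Any pair of indices can be moved into [A], so that only ties inside [A] have to
   be excluded. *)
Lemma no_ties_setU1 (I : finType) (A : {set I}) (e : I) (Y : I -> Omega -> R) :
  (1 < #|A|)%N -> (forall i, measurable_fun setT (Y i)) ->
  exchangeable_on P (e |: A)%SET Y -> no_ties_on P A Y ->
  forall i j, i \in (e |: A)%SET -> j \in (e |: A)%SET -> i != j ->
  P [set w | Y i w = Y j w] = 0%E.
Proof.
move=> /card_gt1P[a [b [aA bA ab]]] mY exch ties i j iA j_A ij.
have sA : {subset A <= (e |: A)%SET} by move=> x xA; rewrite !inE xA orbT.
(* The first factor sends [i] to [a]; the second sends the image of [j] to [b] and leaves [a]
   alone. *)
pose pi := (tperm i a * tperm (tperm i a j) b)%g.
have pii : pi i = a.
  rewrite /pi permM tpermL tpermD //; last by rewrite eq_sym.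
  by rewrite -[X in _ != X](tpermL i a) (inj_eq perm_inj) eq_sym.
have pij : pi j = b by rewrite /pi permM tpermL.
have piA : perm_on (e |: A)%SET pi.
  have aA' := sA _ aA; have bA' := sA _ bA.
  by apply: perm_onM; apply: perm_on_tperm => //; case: tpermP.
rewrite -(exchangeable_eq exch piA iA j_A) pii pij.
apply: (subset_measure0 _ _ _ ties); first exact: measurable_eq_event.
  rewrite (_ : [set w | _] =
    \bigcup_(p in [set p : I * I | [&& p.1 \in A, p.2 \in A & p.1 != p.2]])
       [set w | Y p.1 w = Y p.2 w]).
    by apply: fin_bigcup_measurable => // p _; exact: measurable_eq_event.
  apply/seteqP; split => w /=.
    by move=> [x [y [xA yA xy e']]]; exists (x, y) => //=; apply/and3P.
  by move=> [[x y] /= /and3P[xA yA xy] e']; exists x, y.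
by move=> w /= e'; exists a, b.
Qed.

End Probability.

(** * The exact rejection probability *)

Lemma expectation_perm_test (R : realType) (d d' : measure_display)
    (Omega : measurableType d) (P : probability Omega R)
    (S : measurableType d') (m : nat)
    (X : {RV P >-> m.-tuple S}) (T : {mfun m.-tuple S >-> R})
    (G : {set 'S_m}) (B : nat) (s : 'I_B -> Omega -> 'S_m) (alpha : R)
    (k := threshold_index #|G| B alpha) (G1 := (1%g |: G)%SET) :
  exchangeable_on P G1 (fun g w => T (permute_data g (X w))) ->
  no_ties_on P G (fun g w => T (permute_data g (X w))) ->
  uniform_draws P X G s -> (1 < #|G|)%N -> (0 < k <= B)%N ->
  ('E_P[fun w => perm_test T G alpha (fun b => s b w) (X w)] =
   ((\sum_(j < #|G1|) few_hits B (B - k) #|G| j)%:R / (#|G1| * #|G| ^ B)%:R)%:E)%E.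
Proof.
move=> exch ties [ms Ps indep] G2 kB; set r := (B - k)%N.
pose Y (g : 'S_m) w : R := T (permute_data g (X w)).
rewrite -/Y in exch ties.
have mY g : measurable_fun setT (Y g).
  by apply: measurableT_comp => //; apply: measurableT_comp => //; exact: measurable_permute_data.
have mTg g : measurable_fun setT (fun x => T (permute_data g x)).
  by apply: measurableT_comp => //; exact: measurable_permute_data.
have aeY := ae_inj (fun i _ => mY i) (no_ties_setU1 G2 mY exch ties).
pose p (f : {ffun 'I_B -> 'S_m}) : R := fine (P [set w | (exceed (Y ^~ w) 1%g f <= r)%N]).
have mexc t (f : 'I_B -> 'S_m) : measurable [set w | (exceed (Y ^~ w) t f <= r)%N].
  exact: measurable_exceed.
have pE (f : {ffun 'I_B -> 'S_m}) : P [set w | (exceed (Y ^~ w) 1%g f <= r)%N] = (p f)%:E.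
  by rewrite fineK // fin_num_measure.
(* For fixed draws [f], exchangeability under [tperm 1 t] gives the same probability for every [t]
   in [G1], whence the factor [#|G1|]. Almost surely there are no ties, and then the double sum over
   [t] and [f] is the constant of [sum_exceed_tperm]. *)
have sump : #|G1|%:R * (\sum_(f : {ffun 'I_B -> 'S_m} | f \in ffun_on G) p f) =
    (\sum_(j < #|G1|) few_hits B r #|G| j)%:R.
  apply: EFin_inj.
  pose E (tf : 'S_m * {ffun 'I_B -> 'S_m}) w :=
    (exceed (Y ^~ w) tf.1 (tperm 1%g tf.1 \o tf.2) <= r)%N.
  rewrite -[RHS](@sum_prob_events _ _ _ P _
    (fun tf => (tf.1 \in G1) && (tf.2 \in ffun_on G)) E); last 2 first.
  - by move=> tf _; exact: mexc.
  - apply: filterS aeY => w yinj.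
    have := sum_exceed_tperm B r yinj; rewrite -/G1 => <-; rewrite natr_sum.
    under [RHS]eq_bigr do rewrite natr_sum.
    by rewrite pair_big.
  rewrite -(pair_big (mem G1) (mem (ffun_on G)) (fun t f => P [set w | E (t, f) w])) /=.
  rewrite mulr_natl -sumr_const -sumEFin; apply: eq_bigr => t tG1.
  rewrite -sumEFin; apply: eq_bigr => f fG; rewrite -pE.
  have piG1 : perm_on G1 (tperm 1%g t) by apply: perm_on_tperm => //; rewrite !inE eqxx.
  rewrite -(exchangeable_exceed r exch piG1 (t := 1%g) (f := f)).
  - by rewrite tpermL.
  - by rewrite !inE eqxx.
  - by move=> b; rewrite !inE (ffun_onP fG) orbT.
(* By independence a vector of draws from [G] has weight [#|G| ^- B] whatever the data; any other
   vector has weight zero. *)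
have P_draw (f : {ffun 'I_B -> 'S_m}) :
    (P [set w | (exceed (Y ^~ w) 1%g f <= r)%N && [forall b, s b w == f b]] =
     (if f \in ffun_on G then p f * (#|G|%:R ^- B) else 0)%:E)%E.
  pose D := [set x | (exceed (fun g => T (permute_data g x)) 1%g f <= r)%N].
  have mD : measurable D by exact: measurable_exceed.
  have := indep D (fun b => finset.set1 (f b)) mD.
  rewrite pE.
  rewrite (_ : [set w | _ /\ _] =
    [set w | (exceed (Y ^~ w) 1%g f <= r)%N && [forall b, s b w == f b]]).
    move=> ->.
    have Psf b : P [set w | s b w \in finset.set1 (f b)] =
        (if f b \in G then #|G|%:R^-1 else 0)%:E.
      rewrite -(Ps b (f b)); congr (P _); apply/seteqP.
      by split => w /=; rewrite finset.in_set1 => /eqP.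
    under eq_bigr do rewrite Psf.
    rewrite prodEFin -EFinM; congr EFin; case: ifP => fG.
      rewrite (eq_bigr (fun=> #|G|%:R^-1)); last by move=> b _; rewrite (ffun_onP fG).
      by rewrite prodr_const card_ord exprVn.
    have /forallPn[b fb] := negbT fG.
    by rewrite (bigD1 b) //= (negbTE fb) mul0r mulr0.
  apply/seteqP; split => w /=.
    by move=> [Dw sw]; apply/andP; split => //; apply/forallP => b; have := sw b; rewrite finset.in_set1.
  move=> /andP[Dw /forallP sw]; split => // b; rewrite finset.in_set1; exact: sw.
(* Split according to the realised vector of draws: exactly one [f] contributes. *)
have -> : (fun w => perm_test T G alpha (s ^~ w) (X w)) =
    (fun w => \sum_(f : {ffun 'I_B -> 'S_m})
       ((exceed (Y ^~ w) 1%g f <= r)%N && [forall b, s b w == f b])%:R).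
  apply/funext => w; rewrite perm_testE // (bigD1 [ffun b => s b w]) //=.
  rewrite big1 ?addr0 => [|f]; last first.
    move=> fs; case: forallP => [sf|_]; last by rewrite andbF.
    by case/eqP: fs; apply/ffunP => b; rewrite ffunE (eqP (sf b)).
  have -> : [forall b, s b w == [ffun b => s b w] b] by apply/forallP => b; rewrite ffunE.
  rewrite andbT; congr (nat_of_bool (_ <= _)%N)%:R.
  by apply: eq_exceed => // b; rewrite ffunE.
rewrite expectation_sum_events => [|f _]; last first.
  rewrite (_ : [set w | _] = [set w | (exceed (Y ^~ w) 1%g f <= r)%N] `&`
     \bigcap_(b in [set: 'I_B]) [set w | s b w = f b]).
    by apply: measurableI => //; apply: fin_bigcap_measurable => // b _; exact: ms.
  apply/seteqP; split => w /=.
    by move=> /andP[? /forallP sf]; split => // b _; exact/eqP/sf.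
  by move=> [? sf]; apply/andP; split => //; apply/forallP => b; apply/eqP/sf.
under eq_bigr do rewrite P_draw.
rewrite sumEFin -big_mkcond -mulr_suml -sump; congr EFin.
have G1_0 : #|G1|%:R != 0 :> R.
  by rewrite pnatr_eq0 -lt0n; apply/card_gt0P; exists 1%g; rewrite !inE eqxx.
by rewrite natrM natrX invfM mulrACA mulfV // mul1r.
Qed.

(** * Numerical bounds and conclusion *)

Lemma few_hits_mean (R : realFieldType) (n r N M : nat) :
  (r < n)%N -> (0 < N)%N -> (N <= M <= N.+1)%N ->
  r.+1%:R / n.+1%:R - N%:R^-1 <=
    ((\sum_(j < M) few_hits n r N j)%:R / (M * N ^ n)%:R : R)
    <= r.+1%:R / n.+1%:R + N%:R^-1.
Proof.
move=> rn N0 NM; set F := few_hits n r N.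
have -> : (\sum_(j < M) F j = \sum_(j < N) F j)%N.
  have [->//|->] : M = N \/ M = N.+1 by lia.
  by rewrite big_ord_recr /= [F N]few_hits_all // addn0.
set A := (\sum_(j < N) F j)%N.
have lb : (r.+1 * N ^ n.+1 <= n.+1 * A)%N by apply: few_hits_sum_lb; exact: ltnW.
(* Adding [F 0 <= N ^ n] to the sum of the [F j.+1] gives a sum over [0, ..., N], which is at least
   [A]. *)
have ub : (n.+1 * A <= r.+1 * N ^ n.+1 + n.+1 * N ^ n)%N.
  rewrite addnC (leq_trans _ (leq_add (leqnn _) (few_hits_sum_ub n r N))) //.
  rewrite -mulnDr leq_mul2l (leq_trans _ (leq_add (few_hits_le n r (leq0n N)) (leqnn _))) //.
  by rewrite -(big_ord_recl N F) big_ord_recr leq_addr.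
have Nn0 : (N ^ n)%:R != 0 :> R by rewrite pnatr_eq0 -lt0n expn_gt0 N0.
have [a AE] : exists a : R, A%:R = a * (N ^ n)%:R.
  by exists (A%:R / (N ^ n)%:R); rewrite divfK.
have Nn_gt0 : 0 < (N ^ n)%:R :> R by rewrite ltr0n expn_gt0 N0.
have lba : r.+1%:R * N%:R <= n.+1%:R * a.
  rewrite -(ler_pM2r Nn_gt0) -!mulrA -AE -!natrM ler_nat.
  by rewrite -expnS.
have uba : n.+1%:R * a <= r.+1%:R * N%:R + n.+1%:R.
  rewrite -(ler_pM2r Nn_gt0) mulrDl -!mulrA -AE -!natrM -natrD ler_nat.
  by rewrite -expnS.
have -> : A%:R / (M * N ^ n)%:R = a / M%:R :> R.
  by rewrite AE natrM -mulf_div divff // mulr1.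
clear AE lb ub Nn0 Nn_gt0 A F.
have N0R : 0 < N%:R :> R by rewrite ltr0n.
have n0R : 0 < n.+1%:R :> R by rewrite ltr0n.
have M0R : 0 < M%:R :> R by rewrite ltr0n; lia.
have NMR : N%:R <= (M%:R : R) <= N%:R + 1 by rewrite natr1 !ler_nat.
have rnR : r.+1%:R <= n.+1%:R :> R by rewrite ler_nat; lia.
have r0R : 0 <= r.+1%:R :> R by [].
move: (r.+1%:R : R) (n.+1%:R : R) (N%:R : R) (M%:R : R) a lba uba N0R n0R M0R NMR rnR r0R.
move=> {rn N0 NM r n N M} r n N M a lba uba N0 n0 M0 /andP[NM MN] rn r0.
(* From here [r] and [n] are real numbers standing for the former [r.+1] and [n.+1]. The lower bound
   survives division by [M] instead of [N] because [M - N <= 1] and [r <= n]. *)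
apply/andP; split.
  rewrite ler_pdivlMr //.
  have -> : (r / n - N^-1) * M = r * M / n - M / N by ring.
  have h1 : 1 <= M / N by rewrite ler_pdivlMr // mul1r.
  have h2 : r * N / n <= a by rewrite ler_pdivrMr // [a * n]mulrC.
  have h3 : r * M / n - r * N / n <= 1.
    rewrite -mulrBl ler_pdivrMr // mul1r -mulrBr (le_trans _ rn) //.
    rewrite -[leRHS]mulr1 ler_wpM2l //; lra.
  lra.
rewrite ler_pdivrMr //.
have a0 : a <= r * N / n + 1.
  by rewrite -[X in _ + X](mulfV (lt0r_neq0 n0)) -mulrDl ler_pdivlMr // mulrC.
apply: le_trans a0 _.
have -> : r * N / n + 1 = (r / n + N^-1) * N by field; rewrite !lt0r_neq0.
by rewrite ler_wpM2l // addr_ge0 // ?divr_ge0 ?invr_ge0 // ltW.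
Qed.

Lemma absz_ceil_itv (R : realType) (x : R) :
  0 <= x -> x <= `|Num.ceil x|%N%:R < x + 1.
Proof.
move=> x0; have c0 : 0 <= Num.ceil x by rewrite -(ceil0 R) le_ceil.
have -> : `|Num.ceil x|%N%:R = (Num.ceil x)%:~R :> R by rewrite natr_absz ger0_norm.
by rewrite ceil_ge -ltrBlDr -[1 in X in X < _]/(1%:~R) -intrB gt_pred_ceil.
Qed.

(* P is the law of the data and of the random permutations under the null
   hypothesis.  T(X) is compared with the T(X_sigma), so the exchangeable family
   includes T(X) itself, i.e. it is indexed by G together with the identity; this
   is the family (T(X_sigma))_(sigma in G) when the identity belongs to G. *)
Theorem corollary4 (R : realType) (d d' : measure_display)
    (Omega : measurableType d) (P : probability Omega R)
    (S : measurableType d') (m : nat)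
    (X : {RV P >-> m.-tuple S}) (T : {mfun m.-tuple S >-> R})
    (G : {set 'S_m}) (B : nat) (sigma_star : 'I_B -> Omega -> 'S_m) (alpha : R)
    (alpha_gt0 : 0 < alpha) (alpha_lt1 : alpha < 1)
    (exch : exchangeable_on P (1%g |: G)
       (fun sigma w => T (permute_data sigma (X w))))
    (no_ties : no_ties_on P G (fun sigma w => T (permute_data sigma (X w))))
    (le_B_G : (B <= #|G|)%N)
    (draws : uniform_draws P X G sigma_star) :
  ((alpha - (2 + alpha * (B == #|G|)%:R) / B.+1%:R - (#|G|%:R)^-1)%:E
     <= 'E_P[fun w => perm_test T G alpha (fun b => sigma_star b w) (X w)]
     <= alpha%:E)%E.
Proof.
set k := threshold_index #|G| B alpha.
have B1 : B.+1%:R = B%:R + 1 :> R by rewrite -natr1.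
have B0 : 0 <= B%:R :> R by [].
have kitv : exists K : nat, if B == #|G|
    then k = K.+2 /\ B%:R * (1 - alpha) <= K%:R < B%:R * (1 - alpha) + 1
    else k = K.+1 /\ B.+1%:R * (1 - alpha) <= K%:R < B.+1%:R * (1 - alpha) + 1.
  rewrite /k /threshold_index; case: ifP => _; eexists.
    by split; [rewrite addn2|apply: absz_ceil_itv; apply: mulr_ge0 => //; lra].
  by split; [rewrite addn1|apply: absz_ceil_itv; apply: mulr_ge0 => //; lra].
case: kitv => K kK.
(* If [k] exceeds [B] the test never rejects; then [alpha] is so small that the claimed lower bound
   is nonpositive. *)
have [kB|Bk] := leqP k B; last first.
  rewrite (_ : (fun w => _) = cst 0); last by apply/funext => w; exact: perm_test_over.
  rewrite expectation_cst !lee_fin (ltW alpha_gt0) andbT.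
  have : 0 <= #|G|%:R^-1 :> R by rewrite invr_ge0.
  suff : alpha <= (2 + alpha * (B == #|G|)%:R) / B.+1%:R.
    by move=> le_alpha inv_ge0; rewrite -addrA -opprD subr_le0 (le_trans le_alpha) // lerDl.
  rewrite ler_pdivlMr ?ltr0n //; move: kK Bk; rewrite B1; case: ifP => _ [-> /andP[_ Klt]] Bk.
    have : B%:R <= K%:R + 1 :> R by rewrite natr1 ler_nat; lia.
    by rewrite /=; lra.
  have : B%:R <= K%:R :> R by rewrite ler_nat; lia.
  by rewrite /=; lra.
have k0 : (0 < k)%N by case: (B == _) kK => -[-> _].
(* If [B = #|G|] then [2 <= k <= B]; otherwise [1 <= k <= B < #|G|]. *)
have G2 : (1 < #|G|)%N.
  move: kK kB; case: eqP => [BG|BG] [-> _] kB; first by rewrite -BG (leq_trans _ kB).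
  by rewrite (@leq_ltn_trans B) ?(leq_trans _ kB) // ltn_neqAle le_B_G andbT; apply/eqP.
rewrite expectation_perm_test ?k0 // -/k !lee_fin.
set G1 := (1%g |: G)%SET.
have M12 : (#|G| <= #|G1| <= #|G|.+1)%N.
  by rewrite cardsU1; case: (_ \notin _); rewrite ?add1n ?add0n ?leqnn ?leqnSn.
have rB : (B - k < B)%N by rewrite ltn_subrL k0 (leq_trans k0 kB).
have := few_hits_mean R rB (ltnW G2) M12.
move: (_ / (_ * _)%:R) => E /andP[lE uE].
have BrE : ((B - k).+1%:R = B.+1%:R - k%:R :> R) by rewrite -natrB ?subSn // leqW.
have r1 : 1 <= (B - k).+1%:R :> R by rewrite ler1n.
move: lE uE r1; rewrite BrE B1 => lE uE r1.
have N0 : 0 < #|G|%:R :> R by rewrite ltr0n; lia.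
have b0 : 0 < B%:R + 1 :> R by lra.
move: kK; case: eqP => [BG|BG] [kE /andP[Kge Klt]].
  have kR : k%:R = K%:R + 2 :> R by rewrite kE -addn2 natrD.
  rewrite kR -?BG in lE uE r1 N0 *.
  apply/andP; split.
    apply: le_trans lE; rewrite lerD2r.
    rewrite lerBlDr -mulrDl ler_pdivlMr //=; lra.
  apply: le_trans uE _.
  (* With [N = B], the bound [K >= B (1 - alpha)] leaves [1 / B <= (1 + alpha) / (B + 1)] to check,
     i.e. [B alpha >= 1]. Indeed [r1] says [K <= B - 2], so [B alpha >= 2]. *)
  rewrite -(ler_pM2r b0) mulrDl divfK ?lt0r_neq0 // -(ler_pM2r N0) mulrDl.
  rewrite mulrAC mulVf ?lt0r_neq0 // mul1r; nra.
have kR : k%:R = K%:R + 1 :> R by rewrite kE -addn1 natrD.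
rewrite kR B1 in lE uE r1 Kge Klt *.
apply/andP; split.
  apply: le_trans lE; rewrite lerD2r.
  rewrite lerBlDr -mulrDl ler_pdivlMr //=; lra.
apply: le_trans uE _.
(* Since [B < #|G|], the error [1 / #|G|] is at most [1 / (B + 1)], which the extra 1 in the
   threshold index absorbs. *)
have bN : B%:R + 1 <= #|G|%:R :> R by rewrite natr1 ler_nat; lia.
have : #|G|%:R^-1 <= (B%:R + 1)^-1 :> R by rewrite lef_pV2 ?posrE.
suff : (B%:R + 1 - (K%:R + 1)) / (B%:R + 1) + (B%:R + 1)^-1 <= alpha.
  by move=> le_alpha le_inv; apply: le_trans le_alpha; rewrite lerD2l.
rewrite -[X in _ + X]mul1r -mulrDl ler_pdivrMr //; lra.
Qed.
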